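(* Let $\Gamma$ be a metric graph. Then there exist an integer $n\ge1$ and rational functions $f_1,\dots,f_n$ on $\Gamma$ such that the rational map $\Gamma\to\boldsymbol{TP}^{n-1}$, $x\mapsto(f_1(x):\cdots:f_n(x))$, is an embedding of $\Gamma$ into the tropical projective space $\boldsymbol{TP}^{n-1}$.
   Context: Metric graph: the underlying ($\infty$-)metric space of an edge-weighted graph $(G,l)$, where $G$ is a finite connected nonempty multigraph (loops allowed) and $l:E(G)\to\mathbb{R}_{>0}\cup\{\infty\}$ may take the value $\infty$ only on leaf edges (edges adjacent to a vertex of valence one). Each edge $e$ is identified with $[0,l(e)]$; if $l(e)=\infty$ the leaf end of $e$ is identified with $\infty$ and is called a point at infinity. A rational function on $\Gamma$ is the constant $-\infty$ or a piecewise linear function with integer slopes and finitely many pieces, taking values $\pm\infty$ only at points at infinity. $\boldsymbol{T}=\mathbb{R}\cup\{-\infty\}$ and $\boldsymbol{TP}^{n-1}=(\boldsymbol{T}^{n}\setminus\{(-\infty,\dots,-\infty)\})/\sim$, where $\boldsymbol{x}\sim\boldsymbol{y}$ iff $\boldsymbol{x}=\boldsymbol{y}+(\lambda,\dots,\lambda)$ for some real $\lambda$. Rational maps are extended continuously at points at infinity. An embedding is a map that is a homeomorphism onto its image. *)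

(* Defs.v *)
From HB Require Import structures.
From mathcomp Require Import all_boot all_order all_algebra generic_quotient.
From mathcomp Require Import all_classical all_reals all_analysis.

Set Implicit Arguments.
Unset Strict Implicit.
Unset Printing Implicit Defensive.

Import Order.TTheory GRing.Theory Num.Theory.
Import numFieldNormedType.Exports.

Local Open Scope classical_set_scope.
Local Open Scope ring_scope.
Local Open Scope quotient_scope.

Section Multigraph.
Context {V E : finType} (src tgt : E -> V).

(* A loop at v counts twice. *)
Definition valence_of (v : V) : nat :=
  #|[pred e | src e == v]| + #|[pred e | tgt e == v]|.

Definition adjacent_by : rel V := fun u v =>
  [exists e, ((src e == u) && (tgt e == v)) || ((src e == v) && (tgt e == u))].

End Multigraph.

(* Edges are undirected as far as the graph is concerned; the ordering of the *)
(* two ends of e records the identification of e with [0, len e], with src e  *)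
(* at 0 and tgt e at len e. The last field therefore says both that an edge   *)
(* of infinite length is a leaf edge and that its leaf end is placed at       *)
(* infinity.                                                                  *)
Record weighted_graph (R : realType) := WeightedGraph {
  vertex : finType;
  edge : finType;
  src : edge -> vertex;
  tgt : edge -> vertex;
  len : edge -> \bar R;
  vertex_nonempty : (0 < #|vertex|)%N;
  graph_connected : forall u v : vertex, connect (adjacent_by src tgt) u v;
  len_gt0 : forall e, (0 < len e)%E;
  len_leaf : forall e, len e = +oo%E -> valence_of src tgt (tgt e) = 1%N
}.

Section MetricGraph.
Context {R : realType} (G : weighted_graph R).

(* The vertices are included as separate one-point cells so that the graph    *)
(* with one vertex and no edge yields a point. A cell is a subspace of \bar R *)
(* with its usual topology, so [0, +oo] is a compact interval.                *)
Definition cell (i : (vertex G + edge G)%type) : set (\bar R) :=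
  match i with
  | inl _ => [set 0%E]
  | inr e => [set t | (0 <= t <= len e)%E]
  end.

Definition cells : Type := {i : (vertex G + edge G)%type & set_type (cell i)}.

HB.instance Definition _ := Topological.on cells.

Definition vertex_cell (v : vertex G) : cells :=
  existT (fun i => set_type (cell i)) (inl v)
         (exist (fun t => t \in cell (inl v)) 0%E (mem_set erefl)).

Definition edge_cell (e : edge G) (t : set_type (cell (inr e))) : cells :=
  existT (fun i => set_type (cell i)) (inr e) t.

(* Sends the ends of each edge to the vertices they are attached to and fixes *)
(* all other points; two points are glued iff they have the same image.       *)
Definition attach (x : cells) : cells :=
  match projT1 x with
  | inl _ => x
  | inr e => if set_val (projT2 x) == 0%E then vertex_cell (src e)
             else if set_val (projT2 x) == len e then vertex_cell (tgt e)
             else x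
  end.

Definition glued : rel cells := fun x y => attach x == attach y.

Lemma glued_refl : reflexive glued.
Proof. by move=> x; rewrite /glued. Qed.

Lemma glued_sym : symmetric glued.
Proof. by move=> x y; rewrite /glued eq_sym. Qed.

Lemma glued_trans : transitive glued.
Proof. by move=> y x z; rewrite /glued => /eqP->. Qed.

Canonical glued_equiv := EquivRel glued glued_refl glued_sym glued_trans.

Definition metric_graph : Type := {eq_quot glued_equiv}.

HB.instance Definition _ := Quotient.on metric_graph.
HB.instance Definition _ :=
  Topological.copy metric_graph (quotient_topology {eq_quot glued_equiv}).

Definition edge_point (e : edge G) (t : set_type (cell (inr e))) :
  metric_graph := \pi_metric_graph (edge_cell t).

Definition at_infinity : set metric_graph :=
  [set x | exists (e : edge G) (t : set_type (cell (inr e))),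
             set_val t = +oo%E /\ x = edge_point t].

(* The points of e at finite distance from its 0-end are covered by finitely  *)
(* many intervals, on each of which f is affine with integer slope.           *)
Definition affine_pieces (f : metric_graph -> \bar R) (e : edge G) : Prop :=
  exists (k : nat) (I : 'I_k -> interval R) (a : 'I_k -> int) (b : 'I_k -> R),
    (forall r : R, (0 <= r%:E <= len e)%E -> exists j, r \in I j) /\
    (forall j (t : set_type (cell (inr e))) (r : R),
       set_val t = r%:E -> r \in I j ->
       f (edge_point t) = ((a j)%:~R * r + b j)%:E).

Definition rational_function (f : metric_graph -> \bar R) : Prop :=
  (forall x, f x = -oo%E) \/
  [/\ continuous f,
      forall e, affine_pieces f e &
      forall x, ~ at_infinity x -> f x \is a fin_num].

End MetricGraph.

Arguments at_infinity {R} G.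
Arguments rational_function {R} G f.

Section TropicalProjectiveSpace.
Context (R : realType) (n : nat).

(* T^n minus (-oo, ..., -oo), inside the product (\bar R)^n, where T is the   *)
(* subspace of \bar R of elements other than +oo.                             *)
Definition hcoords : set {ptws 'I_n -> \bar R} :=
  [set x | (forall i, x i != +oo%E) /\ (exists i, x i != -oo%E)].

Definition hcoordsT : Type := set_type hcoords.

HB.instance Definition _ := Topological.on hcoordsT.

Definition tropically_proportional : rel hcoordsT := fun x y =>
  `[< exists lambda : R, forall i, set_val x i = (set_val y i + lambda%:E)%E >].

Lemma tropically_proportional_refl : reflexive tropically_proportional.
Proof. by move=> x; apply/asboolP; exists 0 => i; rewrite adde0. Qed.

Let prop_sym (x y : hcoordsT) :
  tropically_proportional x y -> tropically_proportional y x.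
Proof.
move=> /asboolP[l xy]; apply/asboolP; exists (- l) => i.
by rewrite xy -addeA -EFinD subrr adde0.
Qed.

Lemma tropically_proportional_sym : symmetric tropically_proportional.
Proof. by move=> x y; apply/idP/idP; exact: prop_sym. Qed.

Lemma tropically_proportional_trans : transitive tropically_proportional.
Proof.
move=> y x z /asboolP[l xy] /asboolP[m yz]; apply/asboolP; exists (m + l) => i.
by rewrite xy yz EFinD addeA.
Qed.

Canonical tropically_proportional_equiv :=
  EquivRel tropically_proportional tropically_proportional_refl
    tropically_proportional_sym tropically_proportional_trans.

(* n is the number of homogeneous coordinates: this is TP^(n-1). *)
Definition tropical_proj : Type := {eq_quot tropically_proportional_equiv}.

HB.instance Definition _ := Quotient.on tropical_proj.
HB.instance Definition _ := Topological.copy tropical_proj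
  (quotient_topology {eq_quot tropically_proportional_equiv}).

(* The point p has homogeneous coordinates x. *)
Definition has_hcoords (x : 'I_n -> \bar R) (p : tropical_proj) : Prop :=
  exists y : hcoordsT, set_val y = x /\ p = \pi_tropical_proj y.

End TropicalProjectiveSpace.

(* phi is (f_1 : ... : f_n) extended continuously at the points at infinity.  *)
(* The first condition excludes f_1 = ... = f_n = -oo; the second             *)
(* gives the value wherever (f_1 x, ..., f_n x) lies in T^n \ {-oo}; at a     *)
(* point at infinity where it does not, continuity determines the value.      *)
Definition rational_map (R : realType) (G : weighted_graph R) (n : nat)
    (f : 'I_n -> metric_graph G -> \bar R)
    (phi : metric_graph G -> tropical_proj R n) : Prop :=
  [/\ forall x, ~ at_infinity G x -> hcoords (fun i => f i x),
      forall x, hcoords (fun i => f i x) ->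
        has_hcoords (fun i => f i x) (phi x) &
      continuous phi].

(* A homeomorphism onto the image, which carries the subspace topology. *)
Definition embedding (X Y : topologicalType) (f : X -> Y) : Prop :=
  exists (h : X -> set_type (range f)) (g : set_type (range f) -> X),
    [/\ forall x, set_val (h x) = f x,
        cancel h g, cancel g h, continuous h & continuous g].

(* Main.v *)
Require Import Defs.
From mathcomp Require Import all_boot all_order all_algebra generic_quotient.
From mathcomp Require Import all_classical all_reals all_analysis.
From mathcomp Require Import ring lra.

Set Implicit Arguments.
Unset Strict Implicit.
Unset Printing Implicit Defensive.

Import Order.TTheory GRing.Theory Num.Theory.
Import numFieldNormedType.Exports.

Local Open Scope classical_set_scope.
Local Open Scope ring_scope.
Local Open Scope quotient_scope.

(* All coordinates are continuous with values below +oo: on an edge of finite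
   length l they have the form max (h u - p t, h v - q (l - t)), where h u and h v
   are the values at its two ends, and on an infinite edge the form h u - p t, so
   that they may tend to -oo but never to +oo. One coordinate is the constant 0,
   hence the map lifts to T^n and is injective as soon as the coordinates separate
   points. It is then an embedding because the graph is compact and the projective
   space is Hausdorff; the latter holds since the functions
   exp (y_i) / sum_j exp (y_j) are continuous on it and separate points. *)

(** * Compactness, and embeddings of compact spaces *)

(** Closed subsets of [X] are compact, so [f] maps them to compact, hence closed, subsets of [Y];
    this makes the inverse continuous. *)
Lemma compact_hausdorff_embedding (X Y : topologicalType) (f : X -> Y) :
  compact [set: X] -> hausdorff_space Y -> continuous f -> injective f ->
  embedding f.
Proof.
move=> cptX hY cf injf.
pose h (x : X) : set_type (range f) :=
  exist _ (f x) (mem_set (imageP f (I : [set: X] x))).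
have ex (y : set_type (range f)) : exists x, f x = set_val y.
  by case: (set_valP y) => x _ fx; exists x.
have [g gP] := choice ex.
exists h, g; split => //.
- by move=> x; apply: injf; rewrite gP.
- by move=> y; apply: val_inj; rewrite /= gP.
- apply/continuousP => A [B oB <-].
  rewrite -comp_preimage; have /continuousP := cf; exact.
- apply/continuous_closedP => C cC.
  have -> : g @^-1` C = set_val @^-1` (f @` C).
    apply/seteqP; split => y /=; first by move=> Cy; exists (g y).
    by case=> x Cx; rewrite -gP => /injf <-.
  have cfC : closed (f @` C).
    apply: compact_closed => //; apply: continuous_compact.
      exact: continuous_subspaceT.
    by apply: (subclosed_compact cC cptX).
  have /continuous_closedP := @initial_continuous _ _ (@set_val _ (range f)).
  exact.
Qed.

(** A filter on the subtype is pushed forward along the inclusion; a cluster point of the image in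
    [A] is one of the filter itself. *)
Lemma compact_set_type (X : topologicalType) (A : set X) :
  compact A -> compact [set: set_type A].
Proof.
move=> cptA F FF _.
have FA : (set_val @ F) A by apply: (@filterE _ F) => t /=; exact: (set_valP t).
have [x [Ax clx]] := cptA _ _ FA.
exists (exist _ x (mem_set Ax)); split => // B C FB.
rewrite nbhsE => -[_ [[D oD <-] /= Dx] DC].
have [||_ [[b Bb <-] Db]] := clx (set_val @` B) D.
- by apply: (@filterS _ F _ B) => // b Bb; exists b.
- exact: open_nbhs_nbhs.
by exists b; split => //; exact: DC.
Qed.

Lemma ereal_segment_compact (R : realType) (l : \bar R) :
  (0 <= l)%E -> compact [set t : \bar R | (0 <= t <= l)%E].
Proof.
have fin_compact (r : R) : compact [set t : \bar R | (0 <= t <= r%:E)%E].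
  rewrite (_ : [set t | _] = EFin @` `[0, r]).
    apply: continuous_compact; last exact: segment_compact.
    apply: continuous_subspaceT => x.
    by apply: cvg_EFin; [exact: nearW | exact: cvg_id].
  rewrite set_itvE; apply/seteqP; split => [[t| |] //= tr|_ [t tr <-]];
    last exact: tr.
    by exists t.
  by case/andP: tr; rewrite leye_eq.
case: l => [r _|_|//]; first exact: fin_compact.
move=> F FF F0.
have [clF|] := pselect (cluster F +oo%E).
  by exists +oo%E; split => //=; rewrite leey.
(* If [+oo] is not a cluster point, some [A] in [F] misses a neighbourhood of [+oo], hence
   everything above some [M]; so [F] contains a part of [[0, M]] and the finite case applies. *)
move=> /existsNP[A] /existsNP[B] /not_implyP[FA] /not_implyP[].
move=> [M [_ MB]] AB0.
have [|x [/= /andP[x0 _] clx]] := fin_compact M F _.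
  apply: filterS (filterI F0 FA) => t /= [/andP[t0 _] At].
  rewrite t0 /= leNgt; apply/negP => Mt.
  by apply: AB0; exists t; split => //; exact: MB.
by exists x; split => //=; rewrite x0 leey.
Qed.

(** The product topology is the supremum of those induced by the evaluations, so convergence is
    tested on each; constant functions show that evaluations are surjective. *)
Lemma ptws_continuous (X Y : topologicalType) (I : choiceType)
    (f : X -> {ptws I -> Y}) :
  (forall i, continuous (fun x => f x i)) -> continuous f.
Proof.
move=> cf x; have FF : Filter (f @ nbhs x) by exact: fmap_filter.
apply/cvg_sup => i; apply/cvg_image.
  by apply/seteqP; split=> v // _; exists (cst v).
move=> W /cf; rewrite /fmap /= !nbhs_simpl /= => Wf.
exists [set g | W (g i)] => //.
by apply/seteqP; split => [_ [g Wg <-]|y Wy] //; exists (cst y).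
Qed.

(** The graph is a quotient of a finite disjoint union of compact cells. *)
Lemma metric_graph_compact (R : realType) (G : weighted_graph R) :
  compact [set: metric_graph G].
Proof.
have cptC : compact [set: cells G].
  apply: sigT_compact; first exact: finite_finset.
  move=> i; apply: compact_set_type; case: i => [v|e] /=.
    exact: compact_set1.
  by apply: ereal_segment_compact; exact/ltW/len_gt0.
rewrite (_ : [set: _] = \pi_(metric_graph G) @` [set: cells G]).
  apply: continuous_compact => //; apply: continuous_subspaceT.
  exact: pi_continuous.
by apply/seteqP; split => // x _; exists (repr x) => //; rewrite reprK.
Qed.

(** * Simplex coordinates and the Hausdorff property of tropical projective space *)

Section TropicalProjectiveSpace.
Context (R : realType) (n : nat).
Implicit Types y z : hcoordsT R n.

(** [expeR] sends [-oo] to 0, so infinite coordinates are recorded by real numbers too; [fine] loses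
    nothing because no coordinate is [+oo]. *)
Definition exp_coord (i : 'I_n) y : R := fine (expeR (set_val y i)).

Lemma hcoordsT_neqy y i : set_val y i != +oo%E.
Proof. by case: (set_valP y) => yy _; exact: yy. Qed.

Lemma exp_coordE i y : (exp_coord i y)%:E = expeR (set_val y i).
Proof.
rewrite /exp_coord fineK // ge0_fin_numE ?expeR_ge0 // ltey expeR_eqy.
exact: hcoordsT_neqy.
Qed.

Lemma exp_coord_ge0 i y : 0 <= exp_coord i y.
Proof. exact/fine_ge0/expeR_ge0. Qed.

Lemma exp_coord_sum_gt0 y : 0 < \sum_i exp_coord i y.
Proof.
have [_ [i yi]] := set_valP y.
rewrite (bigD1 i) //= ltr_wpDr //.
  by apply: sumr_ge0 => j _; exact: exp_coord_ge0.
by rewrite -lte_fin exp_coordE expeR_gt0 // ltNye.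
Qed.

Lemma fine_expeR_cvg (t : \bar R) : t != +oo%E ->
  {for t, continuous (fine \o @expeR R)}.
Proof.
case: t => [r _|//|_].
  move=> U; rewrite /= => nU; apply/nbhs_EFin.
  by have := @continuous_expR R r U nU.
suff : (fine \o @expeR R) t @[t --> -oo%E] --> (0 : R) by [].
have FF : Filter (nbhs (-oo%E : \bar R)) by exact: nbhs_filter.
apply/(@cvgrPdist_lt _ _ _ _ FF) => e e0; near=> t.
(* Below [ln e] the exponential is less than [e]; at [-oo] itself it is 0. *)
have : (t < (ln e)%:E)%E by near: t; exact: ereal_nbhs_ninfty_lt (num_real _).
move: (t) => [s||] //=; last by rewrite subrr normr0.
rewrite lte_fin sub0r normrN ger0_norm ?expR_ge0 // => s_lt.
by rewrite -[ltRHS]lnK ?posrE // ltr_expR.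
Unshelve. all: by end_near. Qed.

Lemma hcoord_continuous i : continuous (fun y => set_val y i).
Proof.
move=> y; apply: (@continuous_comp _ _ _
  (set_val : hcoordsT R n -> {ptws 'I_n -> \bar R})
  (fun f : {ptws 'I_n -> \bar R} => f i)).
  exact: initial_continuous.
exact: proj_continuous.
Qed.

Lemma exp_coord_continuous i : continuous (exp_coord i).
Proof.
move=> y; apply: (@continuous_comp _ _ _ (fun y => set_val y i)
  (fine \o @expeR R)).
  exact: hcoord_continuous.
exact/fine_expeR_cvg/hcoordsT_neqy.
Qed.

(* The homeomorphism from the tropical projective space onto the simplex,
   written in homogeneous coordinates. *)
Definition simplex_coord (i : 'I_n) y : R :=
  exp_coord i y / \sum_j exp_coord j y.

Lemma simplex_coord_continuous i : continuous (simplex_coord i).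
Proof.
have sum_cont : continuous (fun y => \sum_j exp_coord j y).
  apply: continuous_big => [|j _]; first exact: add_continuous.
  exact: exp_coord_continuous.
move=> y; apply: continuousM; first exact: exp_coord_continuous.
by apply: continuousV; [exact/lt0r_neq0/exp_coord_sum_gt0 | exact: sum_cont].
Qed.

Lemma simplex_coord_proportional i y z :
  tropically_proportional y z -> simplex_coord i y = simplex_coord i z.
Proof.
move=> /asboolP[l yz].
have e j : exp_coord j y = exp_coord j z * expR l.
  by apply: EFin_inj; rewrite EFinM !exp_coordE yz expeRD.
rewrite /simplex_coord e; under eq_bigr do rewrite e.
rewrite -mulr_suml -mulf_div divff ?mulr1 //; exact/lt0r_neq0/expR_gt0.
Qed.

Lemma simplex_coord_inj y z :
  (forall i, simplex_coord i y = simplex_coord i z) ->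
  tropically_proportional y z.
Proof.
move=> yz; apply/asboolP.
(* If [y] is [z] shifted by [lambda], the two sums have ratio [expR lambda]; this dictates the
   witness [ln r]. *)
pose r := (\sum_j exp_coord j y) / \sum_j exp_coord j z.
have r0 : 0 < r by rewrite divr_gt0 ?exp_coord_sum_gt0.
exists (ln r) => i; apply: expeR_inj; rewrite expeRD /= lnK ?posrE //.
have e : exp_coord i y = exp_coord i z * r.
  have := yz i; rewrite /simplex_coord => /eqP.
  rewrite eqr_div ?lt0r_neq0 ?exp_coord_sum_gt0 // => /eqP e.
  apply: (@mulIf _ (\sum_j exp_coord j z)).
    exact/lt0r_neq0/exp_coord_sum_gt0.
  rewrite e -mulrA divfK //; exact/lt0r_neq0/exp_coord_sum_gt0.
by rewrite -!exp_coordE e.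
Qed.

(** Each simplex coordinate descends to a continuous real function on the quotient. Points without
    disjoint neighbourhoods have the same values under all of these, hence are equal. *)
Lemma tropical_proj_hausdorff : hausdorff_space (tropical_proj R n).
Proof.
move=> p q clpq; rewrite -(reprK p) -(reprK q); apply/eqmodP.
apply: simplex_coord_inj => i.
pose g (x : tropical_proj R n) := simplex_coord i (repr x).
have cg : continuous g.
  apply: (@repr_comp_continuous _ (tropical_proj R n) _ (simplex_coord i)).
    exact: simplex_coord_continuous.
  move=> y z /eqP/eqmodP yz; apply/eqP; exact: simplex_coord_proportional.
apply: (@Rhausdorff R) => A B gA gB.
have [x [Ax Bx]] := clpq _ _ (cg p A gA) (cg q B gB).
by exists (g x).
Qed.

End TropicalProjectiveSpace.

(** * Points at infinity and normal forms of points *)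

Section GraphFunction.
Context {R : realType} (G : weighted_graph R).
Implicit Types (v : vertex G) (e : edge G).

(** Otherwise the vertex would have valence at least two: [e] counts at its source and [e'] at its
    target, even when they are the same loop. *)
Lemma src_neq_infinite_tgt e e' : len e' = +oo%E -> src e != tgt e'.
Proof.
move=> le'; apply/eqP => se; have := len_leaf le'; rewrite /valence_of.
rewrite (cardD1 e) (cardD1 e' [pred e'' | _ e'' == _]) !inE se !eqxx.
by rewrite addnACA.
Qed.

Lemma infinite_tgt_inj e e' : len e' = +oo%E -> tgt e = tgt e' -> e = e'.
Proof.
move=> le' te; apply/eqP; apply: contraT => ee'.
have := len_leaf le'; rewrite /valence_of addnC.
by rewrite (cardD1 e) (cardD1 e') !inE te !eqxx eq_sym ee'.
Qed.

Lemma attach_tgt e (t : set_type (cell (inr e))) :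
  set_val t = len e -> attach (edge_cell t) = vertex_cell (tgt e).
Proof.
move=> tl; rewrite /attach /= tl gt_eqF ?len_gt0 //.
by have [//|] := eqVneq (len e) (len e); rewrite eqxx.
Qed.

Lemma attachK (x : cells G) : attach (attach x) = attach x.
Proof.
case: x => -[v|e] t //; rewrite {2 3}/attach /=.
case: ifPn => [//|t0]; case: ifPn => [//|tl].
by rewrite /attach /= (negbTE t0) (negbTE tl).
Qed.

Lemma pi_attach (x : cells G) :
  \pi_(metric_graph G) (attach x) = \pi_(metric_graph G) x.
Proof. by apply/eqmodP; rewrite /= /glued attachK. Qed.

(** A point at infinity is presented as the end [+oo] of its edge, never as a vertex; all other ends
    of edges are presented as vertices. *)
Variant graph_point_spec (x : metric_graph G) : Prop :=
| GraphVertex v of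
    (forall e, len e = +oo%E -> tgt e <> v) &
    x = \pi_(metric_graph G) (vertex_cell v)
| GraphEdge e (t : set_type (cell (inr e))) of
    (0 < set_val t)%E & (set_val t < len e)%E \/ len e = +oo%E &
    x = edge_point t.

Lemma graph_pointP (x : metric_graph G) : graph_point_spec x.
Proof.
have vertexP v : graph_point_spec (\pi_(metric_graph G) (vertex_cell v)).
  have [[e /asboolP [le te]]|ne] :=
    pselect (exists e, `[< len e = +oo%E /\ tgt e = v >]).
    have ty : (+oo%E : \bar R) \in cell (inr e : vertex G + edge G).
      by rewrite inE /= le leey lexx.
    apply: (@GraphEdge _ e (exist _ +oo%E ty)); [exact: ltry|by right|].
    rewrite /edge_point -[RHS]pi_attach; congr (\pi _).
    by rewrite attach_tgt ?te //= le.
  apply: (GraphVertex (v := v)) => // e le te.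
  by apply: ne; exists e; apply/asboolP.
rewrite -(reprK x) -pi_attach; case: (repr x) => -[v|e] t.
  have t0 : set_val t = 0%E by have := set_valP t.
  rewrite /attach /= (_ : existT _ _ _ = vertex_cell v) //.
  by congr existT; apply: val_inj.
rewrite /attach /=; case: ifPn => [_|t0]; first exact: vertexP.
case: ifPn => [_|tl]; first exact: vertexP.
have /= /andP[t_ge0 t_le] := set_valP t.
apply: (GraphEdge (t := t)) => //; first by rewrite lt_neqAle eq_sym t0.
by left; rewrite lt_neqAle tl.
Qed.

(** * Rational functions with prescribed vertex values and slopes *)

Section Slopes.
Context (h : vertex G -> R) (p q : edge G -> nat).

(** On an infinite edge the convention [0 * +oo = 0] makes slope 0 give a constant up to and
    including the end. *)
Definition edge_fun e (t : \bar R) : \bar R :=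
  if len e is l%:E then
    (Num.max (h (src e) - (p e)%:R * fine t)
             (h (tgt e) - (q e)%:R * (l - fine t)))%:E
  else ((h (src e))%:E - (p e)%:R%:E * t)%E.

(** At a vertex at infinity [h] is ignored in favour of the value coming from its only edge, so that
    the function respects the gluing. *)
Definition vertex_fun v : \bar R :=
  if [pick e | (len e == +oo%E) && (tgt e == v)] is Some e
  then edge_fun e +oo%E else (h v)%:E.

Definition component_fun (i : (vertex G + edge G)%type) :
    set_type (cell i) -> \bar R :=
  match i with
  | inl v => fun=> vertex_fun v
  | inr e => fun t => edge_fun e (set_val t)
  end.

Definition cell_fun (x : cells G) : \bar R := component_fun (projT2 x).

Definition graph_fun (x : metric_graph G) : \bar R := cell_fun (repr x).

Lemma vertex_fun_finite v :
  (forall e, len e = +oo%E -> tgt e <> v) -> vertex_fun v = (h v)%:E.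
Proof.
move=> vf; rewrite /vertex_fun; case: pickP => // e /andP[/eqP le /eqP te].
by case: (vf e).
Qed.

Lemma vertex_fun_infinite e :
  len e = +oo%E -> vertex_fun (tgt e) = edge_fun e +oo%E.
Proof.
move=> le; rewrite /vertex_fun; case: pickP => [e' /andP[_ /eqP te]|/(_ e)].
  by rewrite (infinite_tgt_inj le te).
by rewrite le !eqxx.
Qed.

(** At each end of a finite edge the line coming from the other end does not exceed the value of
    [h], so the maximum in [edge_fun] equals [h] there. *)
Definition compatible_slopes := forall e l, len e = l%:E ->
  h (tgt e) - (q e)%:R * l <= h (src e) /\
  h (src e) - (p e)%:R * l <= h (tgt e).

Hypothesis hpq : compatible_slopes.

Lemma len_fin_or_infinite e :
  (exists2 l, len e = l%:E & 0 < l) \/ len e = +oo%E.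
Proof.
have := len_gt0 e; case: (len e) => [l l0| |//]; last by right.
by left; exists l; rewrite -?lte_fin.
Qed.

Lemma edge_fun_src e : edge_fun e 0%E = vertex_fun (src e).
Proof.
rewrite vertex_fun_finite /edge_fun; last first.
  by move=> e' le' /esym/eqP; apply/negP/src_neq_infinite_tgt.
have [[l le _]|->] := len_fin_or_infinite e; last by rewrite mule0 sube0.
have [ba _] := hpq le.
by rewrite le /= mulr0 !subr0 max_l.
Qed.

Lemma edge_fun_tgt e : edge_fun e (len e) = vertex_fun (tgt e).
Proof.
have [[l le l0]|le] := len_fin_or_infinite e; last first.
  by rewrite vertex_fun_infinite // le.
rewrite vertex_fun_finite; last first.
  (* A finite edge cannot end at a vertex at infinity, whose only edge is infinite. *)
  by move=> e' le' te'; move: le; rewrite (infinite_tgt_inj le' (esym te')) le'.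
have [_ ab] := hpq le.
by rewrite /edge_fun le /= subrr mulr0 subr0 max_r.
Qed.

Lemma cell_fun_attach (x : cells G) : cell_fun (attach x) = cell_fun x.
Proof.
case: x => -[v|e] t //; rewrite /attach /=.
case: ifPn => [/eqP t0|_].
  by rewrite /cell_fun /= -edge_fun_src t0.
case: ifPn => [/eqP tl|//].
by rewrite /cell_fun /= -edge_fun_tgt tl.
Qed.

Lemma cell_fun_glued (x y : cells G) : glued x y -> cell_fun x = cell_fun y.
Proof. by move=> /eqP xy; rewrite -cell_fun_attach xy cell_fun_attach. Qed.

Lemma graph_fun_pi (x : cells G) :
  graph_fun (\pi_(metric_graph G) x) = cell_fun x.
Proof.
by apply: cell_fun_glued; apply/eqmodP; rewrite reprK.
Qed.

Lemma graph_fun_edge e (t : set_type (cell (inr e))) :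
  graph_fun (edge_point t) = edge_fun e (set_val t).
Proof. exact: graph_fun_pi. Qed.

Lemma graph_fun_vertex v : (forall e, len e = +oo%E -> tgt e <> v) ->
  graph_fun (\pi_(metric_graph G) (vertex_cell v)) = (h v)%:E.
Proof. by move=> vf; rewrite graph_fun_pi -vertex_fun_finite. Qed.

Lemma edge_fun_fin e t : t \is a fin_num -> edge_fun e t \is a fin_num.
Proof.
rewrite /edge_fun; case: t => [r| |] // _.
by have [[l -> _]|->] := len_fin_or_infinite e.
Qed.

Lemma edge_fun_neqy e (t : \bar R) : (0 < t)%E -> edge_fun e t != +oo%E.
Proof.
rewrite /edge_fun; have [[l -> _]|->] := len_fin_or_infinite e => //.
case: t => [r| |] // _; have [->|p0] := posnP (p e).
  by rewrite mul0e sube0.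
by rewrite gt0_muley // lte_fin ltr0n.
Qed.

Lemma graph_fun_neqy x : graph_fun x != +oo%E.
Proof.
have [v vf ->|e t t0 te ->] := graph_pointP x.
  by rewrite graph_fun_vertex.
by rewrite graph_fun_edge edge_fun_neqy.
Qed.

Lemma graph_fun_fin x : ~ at_infinity G x -> graph_fun x \is a fin_num.
Proof.
have [v vf ->|e t t0 te ->] := graph_pointP x.
  by rewrite graph_fun_vertex.
move=> ninf; rewrite graph_fun_edge; apply: edge_fun_fin.
rewrite ge0_fin_numE ?ltW // ltey; apply/eqP => ty.
by apply: ninf; exists e, t.
Qed.

Lemma edge_fun_continuous e (t : \bar R) : (0 <= t <= len e)%E ->
  {for t, continuous (edge_fun e)}.
Proof.
rewrite /edge_fun; have [[l -> _]|-> _] := len_fin_or_infinite e; last first.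
  apply: cvgeB; [|exact: cvg_cst|].
    by rewrite fin_num_adde_defr.
  by apply: cvgeZl => //; exact: cvg_id.
case: t => [r _| |/andP[]//]; last by rewrite leye_eq andbF.
apply: cvg_EFin; first exact: nearW.
have fr : fine @ nbhs r%:E --> r by apply: fine_cvg; exact: cvg_id.
apply: (@continuous_max R _ (fun t => h (src e) - (p e)%:R * fine t)
  (fun t => h (tgt e) - (q e)%:R * (l - fine t)) r%:E).
  by apply: cvgB; [exact: cvg_cst | apply: cvgM; [exact: cvg_cst|]].
apply: cvgB; first exact: cvg_cst.
by apply: cvgM; [exact: cvg_cst | apply: cvgB; [exact: cvg_cst|]].
Qed.

Lemma graph_fun_continuous : continuous graph_fun.
Proof.
apply: (@repr_comp_continuous _ (metric_graph G) _ cell_fun).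
  apply: (@sigT_continuous _ _ _ component_fun) => -[v|e] /=.
    exact: cst_continuous.
  move=> t; apply: (@continuous_comp _ _ _ set_val (edge_fun e)).
    exact: initial_continuous.
  by apply: edge_fun_continuous; have := set_valP t.
by move=> x y /eqP/eqmodP xy; apply/eqP/cell_fun_glued.
Qed.

Lemma graph_fun_affine_pieces e : affine_pieces graph_fun e.
Proof.
have [[l le l0]|le] := len_fin_or_infinite e; last first.
  exists 1%N, (fun=> `]-oo, +oo[), (fun=> - (p e)%:Z), (fun=> h (src e)).
  split=> [r _|j t r tr _]; first by exists ord0.
  rewrite graph_fun_edge tr /edge_fun le /=; congr (_%:E).
  by rewrite rmorphN /= mulNr addrC.
have [ba ab] := hpq le.
have [s [sl sr]] : exists s : R,
    (forall r, r <= s ->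
      h (tgt e) - (q e)%:R * (l - r) <= h (src e) - (p e)%:R * r) /\
    (forall r, s <= r ->
      h (src e) - (p e)%:R * r <= h (tgt e) - (q e)%:R * (l - r)).
  have := ler0n R (p e); have := ler0n R (q e).
  move: (p e)%:R (q e)%:R ba ab => P Q ba ab Q0 P0.
  have [/eqP|PQ] := eqVneq (P + Q) 0.
    (* Both slopes vanish: the two lines are constants, equal by compatibility, and any [s] will
       do. *)
    rewrite paddr_eq0 // => /andP[/eqP P_0 /eqP Q_0]; subst.
    by exists 0; split=> r _; lra.
  have {}PQ : 0 < P + Q by rewrite lt_neqAle eq_sym PQ addr_ge0.
  (* The abscissa where the falling and the rising line cross; the maximum switches from the first
     to the second there. *)
  exists ((h (src e) - h (tgt e) + Q * l) / (P + Q)).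
  by split=> r; rewrite (ler_pdivlMr, ler_pdivrMr) //; nra.
exists 2%N, (fun j => if j == ord0 then `]-oo, s] else `[s, +oo[),
  (fun j => if j == ord0 then - (p e)%:Z else (q e)%:Z),
  (fun j => if j == ord0 then h (src e) else h (tgt e) - (q e)%:R * l).
split=> [r _|j t r tr].
  have [rs|/ltW rs] := leP r s; first by exists ord0; rewrite in_itv.
  by exists (lift ord0 ord0); rewrite in_itv /= rs.
rewrite graph_fun_edge tr /edge_fun le /=; case: eqP => _.
  rewrite in_itv /= => /sl rs; rewrite max_l //.
  by rewrite rmorphN /= mulNr addrC.
rewrite in_itv /= andbT => /sr rs; rewrite max_r //.
by congr (_%:E); rewrite -pmulrn; ring.
Qed.

Lemma graph_fun_rational : rational_function G graph_fun.
Proof.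
right; split.
- exact: graph_fun_continuous.
- exact: graph_fun_affine_pieces.
- exact: graph_fun_fin.
Qed.

End Slopes.
End GraphFunction.

(** * Coordinates separating the points of the graph *)

Section Coordinates.
Context {R : realType} (G : weighted_graph R).

Definition coord_index : finType := option (option (edge G * bool)).

Definition coord_height (i : coord_index) (v : vertex G) : R :=
  if i is Some None then (enum_rank v)%:R else 0.

(** The two tents over an edge fall from its source with slopes 1 and 2, and both rise to the target
    of a finite edge with slope 1. Their minima differ, so together they distinguish points that one
    tent alone would confuse. *)
Definition coord_src_slope (N : nat) (i : coord_index) (e : edge G) : nat :=
  match i with
  | None => 0
  | Some None => N
  | Some (Some (e', b)) => (e == e') * b.+1
  end.

Definition coord_tgt_slope (N : nat) (i : coord_index) (e : edge G) : nat :=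
  match i with
  | None => 0
  | Some None => N
  | Some (Some (e', _)) => e == e'
  end.

(* Coordinate [None] is [0], [Some None] separates the vertices, and the pair of
   tents [Some (Some (e, _))] separates the points of [e] from each other and
   from all other points. *)
Definition coord (N : nat) (i : coord_index) : metric_graph G -> \bar R :=
  graph_fun (coord_height i) (coord_src_slope N i) (coord_tgt_slope N i).

(** Vertex heights will be ranks below the number of vertices; a line of slope [N] must drop by that
    much along every finite edge. *)
Lemma exists_steep_slope :
  exists N : nat, forall (e : edge G) (l : R), len e = l%:E ->
    #|vertex G|%:R <= N%:R * l.
Proof.
(* On an infinite edge [fine] gives 0 and the quotient is 0, so such an edge contributes just 1. *)
pose N (e : edge G) := (Num.truncn (#|vertex G|%:R / fine (len e))).+1.
exists (\max_e N e) => e l le.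
have l0 : 0 < l by have := len_gt0 e; rewrite le lte_fin.
rewrite -ler_pdivrMr //; apply: (@le_trans _ _ (N e)%:R).
  by rewrite /N le /= ltW // truncnS_gt.
by rewrite ler_nat (leq_bigmax e).
Qed.

Context (N : nat).
Hypothesis steep : forall (e : edge G) (l : R), len e = l%:E ->
  #|vertex G|%:R <= N%:R * l.

Lemma coord_compatible i : compatible_slopes
  (coord_height i) (coord_src_slope N i) (coord_tgt_slope N i).
Proof.
move=> e l le; have l0 : 0 <= l by have := len_gt0 e; rewrite le lte_fin => /ltW.
case: i => [[[e' b]|]|] /=; rewrite ?mul0r ?subr0 //.
  by split; rewrite sub0r oppr_le0 mulr_ge0 ?ler0n.
have rank_le (v : vertex G) : (enum_rank v)%:R <= N%:R * l.
  by apply: le_trans (steep le); rewrite ler_nat; exact/ltnW/ltn_ord.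
by split; rewrite lerBlDl ler_wpDr ?rank_le.
Qed.

Lemma coord0 x : coord N None x = 0%E.
Proof.
have [v vf ->|e t t0 te ->] := graph_pointP x.
  by rewrite /coord graph_fun_vertex //; exact: coord_compatible.
rewrite /coord graph_fun_edge /edge_fun; last exact: coord_compatible.
have [[l -> _]|->] := len_fin_or_infinite e; last by rewrite mul0e sube0.
by rewrite /= !mul0r subr0 maxxx.
Qed.

Lemma tent_vertex e b v : (forall e, len e = +oo%E -> tgt e <> v) ->
  coord N (Some (Some (e, b))) (\pi_(metric_graph G) (vertex_cell v)) = 0%E.
Proof.
by move=> vf; rewrite /coord graph_fun_vertex //; exact: coord_compatible.
Qed.

Lemma tent_other_edge e b e' (t : set_type (cell (inr e' : vertex G + edge G))) :
  e' != e -> coord N (Some (Some (e, b))) (edge_point t) = 0%E.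
Proof.
move=> /negbTE ee'; rewrite /coord graph_fun_edge; last exact: coord_compatible.
move: (set_val t) => s; rewrite /edge_fun /= ee'.
have [[l -> _]|->] := len_fin_or_infinite e'.
  by rewrite !mul0r subr0 maxxx.
by rewrite mul0e sube0.
Qed.

Lemma tent_finite e b (t : set_type (cell (inr e : vertex G + edge G))) l :
  len e = l%:E -> coord N (Some (Some (e, b))) (edge_point t) =
    (Num.max (- (b.+1%:R * fine (set_val t))) (fine (set_val t) - l))%:E.
Proof.
move=> le; rewrite /coord graph_fun_edge /edge_fun; last exact: coord_compatible.
by rewrite le /= eqxx !mul1n mul1r !sub0r opprB.
Qed.

Lemma tent_infinite e b (t : set_type (cell (inr e : vertex G + edge G))) :
  len e = +oo%E -> coord N (Some (Some (e, b))) (edge_point t) =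
    (- (b.+1%:R%:E * set_val t))%E.
Proof.
move=> le; rewrite /coord graph_fun_edge /edge_fun; last exact: coord_compatible.
by rewrite le /= eqxx !mul1n add0e.
Qed.

(** Negativity tells the interior of [e], with its end at infinity if any, from the vertices at
    finite distance and the other edges, where the tent is 0. *)
Lemma tent_lt0 e b (t : set_type (cell (inr e : vertex G + edge G))) :
  (0 < set_val t)%E -> (set_val t < len e)%E \/ len e = +oo%E ->
  (coord N (Some (Some (e, b))) (edge_point t) < 0)%E.
Proof.
move=> t0 te; have [[l le l0]|le] := len_fin_or_infinite e; last first.
  by rewrite tent_infinite // oppe_lt0 mule_gt0 // lte_fin ltr0n.
case: te; rewrite ?le // => tl; rewrite (tent_finite _ _ le) lte_fin gt_max.
have tf : set_val t \is a fin_num.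
  by rewrite ge0_fin_numE ?ltW // (lt_trans tl) ?ltry.
move: t0 tl; rewrite -(fineK tf) !lte_fin => t0 tl.
by rewrite oppr_lt0 mulr_gt0 //= subr_lt0.
Qed.

Lemma tent_inj e (t t' : set_type (cell (inr e : vertex G + edge G))) :
  (0 < set_val t)%E -> (0 < set_val t')%E ->
  (forall b, coord N (Some (Some (e, b))) (edge_point t) =
             coord N (Some (Some (e, b))) (edge_point t')) -> t = t'.
Proof.
move=> t0 t0' tt'; apply: val_inj; change (set_val t = set_val t').
have [[l le l0]|le] := len_fin_or_infinite e.
  have fin (s : set_type (cell (inr e : vertex G + edge G))) :
      (0 < set_val s)%E ->
      set_val s = (fine (set_val s))%:E /\ 0 < fine (set_val s) <= l.
    have : (0 <= set_val s <= len e)%E := set_valP s.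
    move: (set_val s) => r; rewrite le; case: r => [r /andP[_ rl] r0| |] //=.
      by rewrite -!lte_fin r0.
    by rewrite leye_eq andbF.
  have [-> /andP[]] := fin t t0; have [-> /andP[]] := fin t' t0'.
  have := tt' true; have := tt' false; rewrite !(tent_finite _ _ le).
  move: (fine _) (fine _) => r s [e1] [e2] /= s0 sl r0 rl.
  congr (_%:E); move: e1 e2 => /=.
  (* If distinct [r] and [s] lie on opposite sides of the first tent, then [r + s = l]; the second
     gives [2 * r + s = l] or [r + 2 * s = l], so one of them is 0, which is excluded. *)
  by do 4![case: leP => ?] => ? ?; lra.
have := tt' false; rewrite !tent_infinite // => /oppe_inj.
by rewrite !mul1e.
Qed.

Lemma coord_inj x y : (forall i, coord N i x = coord N i y) -> x = y.
Proof.
move=> xy.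
have [v vf ex|e t t0 te ex] := graph_pointP x;
  have [w wf ey|e' t' t0' te' ey] := graph_pointP y.
- have := xy (Some None); rewrite ex ey /coord !graph_fun_vertex //;
    try exact: coord_compatible.
  by move=> [] /eqP; rewrite eqr_nat => /eqP/val_inj/enum_rank_inj ->.
- have := tent_lt0 false t0' te'.
  by rewrite -ey -xy ex tent_vertex // ltxx.
- have := tent_lt0 false t0 te.
  by rewrite -ex xy ey tent_vertex // ltxx.
- have [ee'|ee'] := eqVneq e' e; last first.
    by have := tent_lt0 false t0 te; rewrite -ex xy ey tent_other_edge // ltxx.
  subst e'; rewrite ex ey; congr edge_point; apply: tent_inj => // b.
  by rewrite -ex -ey.
Qed.

End Coordinates.

(** * Assembling the coordinates into an embedding *)

Theorem corollary1p0p7 (R : realType) (G : weighted_graph R) :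
  exists (n : nat) (f : 'I_n -> metric_graph G -> \bar R)
         (phi : metric_graph G -> tropical_proj R n),
    [/\ (1 <= n)%N,
        forall i, rational_function G (f i),
        rational_map f phi &
        embedding phi].
Proof.
have [N steep] := exists_steep_slope G.
pose n := #|coord_index G|.
pose f (i : 'I_n) := coord N (enum_val i).
(* The constant coordinate 0 keeps every point inside [hcoords], even at infinity, and fixes the
   projective scaling. *)
pose i0 : 'I_n := enum_rank None.
have f_i0 x : f i0 x = 0%E by rewrite /f enum_rankK coord0.
have f_hcoords x : hcoords (fun i => f i x).
  split => [i|]; last by exists i0; rewrite f_i0.
  exact/graph_fun_neqy/coord_compatible.
pose F x : hcoordsT R n := exist _ (fun i => f i x) (mem_set (f_hcoords x)).
have F_cont : continuous F.
  apply: continuous_comp_initial; apply: ptws_continuous => i.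
  exact/graph_fun_continuous/coord_compatible.
pose phi x : tropical_proj R n := \pi_(tropical_proj R n) (F x).
have phi_cont : continuous phi.
  move=> x; apply: continuous_comp; first exact: F_cont.
  exact: pi_continuous.
have phi_inj : injective phi.
  move=> x y /eqmodP/asboolP[l Fxy]; apply: (coord_inj steep) => i.
  (* Comparing the constant coordinates of the two points leaves no shift, so all coordinates
     agree. *)
  have l0 : l = 0.
    by have := Fxy i0; rewrite ![set_val _ _]f_i0 add0e => -[].
  have : f (enum_rank i) x = (f (enum_rank i) y + l%:E)%E := Fxy _.
  by rewrite l0 adde0 /f enum_rankK.
exists n, f, phi; split.
- by rewrite /n card_option.
- by move=> i; exact/graph_fun_rational/coord_compatible.
- by split => // x _; exists (F x).
- apply: compact_hausdorff_embedding => //; first exact: metric_graph_compact.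
  exact: tropical_proj_hausdorff.
Qed.
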